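(* Let $\Omega$ be the set of all submultiplicative weights on $\mathbb{R}^{2d}$ which satisfy the GRS-condition, and for $\varepsilon>0$ let $v_\varepsilon(x)=e^{\varepsilon|x|}$, $x\in\mathbb{R}^{2d}$. Then $$\bigcup_{\varepsilon>0}\ell^1_{(v_\varepsilon)}=\bigcap_{v\in\Omega}\ell^1_{(v)}\quad\text{and}\quad \bigcup_{\varepsilon>0}\mathcal{A}_{v_\varepsilon}=\bigcap_{v\in\Omega}\mathcal{A}_v .$$
   Context: A weight on $\mathbb{R}^{2d}$ is a positive function belonging to $L^\infty_{loc}(\mathbb{R}^{2d})$. A weight $v$ is submultiplicative if it is even and satisfies $v(x+y)\le v(x)v(y)$ for all $x,y\in\mathbb{R}^{2d}$. It satisfies the GRS-condition if $\lim_{\ell\to\infty}v(\ell x)^{1/\ell}=1$ for every $x\in\mathbb{R}^{2d}$ ($\ell$ running over positive integers). Here $|x|$ is the Euclidean norm. For a weight $v$ on $\mathbb{R}^{2d}$, $\ell^1_{(v)}=\ell^1_{(v)}(\mathbb{Z}^{2d})$ is the set of all complex sequences $(c_k)_{k\in\mathbb{Z}^{2d}}$ such that $\sum_{k\in\mathbb{Z}^{2d}}|c_k|v(k)<\infty$, and $\mathcal{A}_v$ is the set of all complex matrices $A=(a(j,k))_{j,k\in\mathbb{Z}^{2d}}$ such that $$\sum_{k\in\mathbb{Z}^{2d}}\Big(\sup_{j\in\mathbb{Z}^{2d}}|a(j,j-k)|\Big)v(k)<\infty .$$ The equalities are equalities of sets. *)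

(* Defs.v *)
From HB Require Import structures.
From mathcomp Require Import all_boot all_order all_algebra.
From mathcomp Require Import all_classical all_reals all_analysis.
From mathcomp Require Export complex.
Import Order.TTheory GRing.Theory Num.Theory.
Import numFieldNormedType.Exports.

Set Implicit Arguments.
Unset Strict Implicit.
Unset Printing Implicit Defensive.

Local Open Scope classical_set_scope.
Local Open Scope ring_scope.

Section LebesgueRn.
Context {R : realType} {n : nat}.
Implicit Types (a b : 'rV[R]_n) (A B K : set 'rV[R]_n) (f : 'rV[R]_n -> R).

Definition box a b : set 'rV[R]_n :=
  [set x | forall i, a ord0 i <= x ord0 i <= b ord0 i].

(* The box is empty as soon as one side is reversed, hence the [max]. *)
Definition box_vol a b : R :=
  \prod_(i < n) Num.max 0 (b ord0 i - a ord0 i).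

(* The covering families are indexed by an arbitrary set [D] of naturals, so
   that finite and empty families are allowed (in dimension 0 every box has
   volume 1). *)
Definition lebesgue_outer A : \bar R :=
  ereal_inf [set s | exists (D : set nat) (a b : nat -> 'rV[R]_n),
    A `<=` \bigcup_(k in D) box (a k) (b k) /\
    s = (\esum_(k in D) (box_vol (a k) (b k))%:E)%E].

Definition lebesgue_null A : Prop := lebesgue_outer A = 0%E.

Definition borel : set (set 'rV[R]_n) := <<s [set A | open A] >>.

(* The Lebesgue sigma-algebra, as the completion of the Borel one. *)
Definition lebesgue_measurable A : Prop :=
  exists2 B, borel B & lebesgue_null ((A `\` B) `|` (B `\` A)).

Definition lebesgue_measurable_fun f : Prop :=
  forall Y : set R, measurable Y -> lebesgue_measurable (f @^-1` Y).

(* Membership in L^oo_loc of an everywhere defined function. *)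
Definition Linfty_loc f : Prop :=
  lebesgue_measurable_fun f /\
  forall K, compact K ->
    exists M : R, lebesgue_null (K `&` [set x | M < `|f x|]).

End LebesgueRn.

Section Weights.
Context {R : realType} {n : nat}.
Implicit Types (v : 'rV[R]_n -> R) (x y : 'rV[R]_n).

(* The norm [`|x|] of the library on row vectors is the sup norm. *)
Definition euclidean_norm x : R := Num.sqrt (\sum_(i < n) x ord0 i ^+ 2).

Definition weight v : Prop := (forall x, 0 < v x) /\ Linfty_loc v.

Definition submultiplicative v : Prop :=
  (forall x, v (- x) = v x) /\ (forall x y, v (x + y) <= v x * v y).

Definition GRS_condition v : Prop :=
  forall x, v (l%:R *: x) `^ (l%:R)^-1 @[l --> \oo] --> (1 : R).

Definition exp_weight (e : R) : 'rV[R]_n -> R :=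
  fun x => expR (e * euclidean_norm x).

Definition int_point (k : 'rV[int]_n) : 'rV[R]_n := map_mx intr k.

Definition weighted_l1 v : set ('rV[int]_n -> R[i]) :=
  [set c | (\esum_(k in [set: 'rV[int]_n])
     (ComplexField.Normc.normc (c k) * v (int_point k))%:E < +oo)%E].

Definition weighted_matrices v : set ('rV[int]_n -> 'rV[int]_n -> R[i]) :=
  [set a | (\esum_(k in [set: 'rV[int]_n])
     (ereal_sup [set (ComplexField.Normc.normc (a j (j - k)))%:E |
                  j in [set: 'rV[int]_n]]
      * (v (int_point k))%:E) < +oo)%E].

End Weights.

Definition Omega (R : realType) (n : nat) : set ('rV[R]_n -> R) :=
  [set v | [/\ weight v, submultiplicative v & GRS_condition v]].
Arguments Omega : clear implicits.

(* Main.v *)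
Require Import Defs.
From mathcomp Require Import all_boot all_order all_algebra.
From mathcomp Require Import all_classical all_reals all_analysis.
From mathcomp Require Import measurable_realfun.
From mathcomp Require Import ring lra.
Import Order.TTheory GRing.Theory Num.Theory.
Import numFieldNormedType.Exports.

(** Both equalities compare the same kind of sum: with s k = |c_k|, respectively
s k = sup_j |a(j, j - k)|, membership means that sum_k s k * v k is finite, so
it is enough to show, for an arbitrary s with values in [0, +oo], that the sum
is finite for some exponential weight if and only if it is finite for every v
in Omega.

From exponential weights to Omega: along each coordinate axis the GRS-condition
makes v(l e_i) smaller than a constant times exp(e' l), and submultiplicativity
multiplies these estimates together. Hence v is dominated on the lattice by a
multiple of exp(e |x|), for every e > 0 ([GRS_exp_bound]).

From Omega to exponential weights: suppose that the sum is infinite for all the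
weights exp(|x| / (m + 1)). One weight v in Omega has to witness this, of the
form v = exp(w(|x|)) with w subadditive and w(t) = o(t). Such functions arise as
infima of affine functions, w(t) = inf_m (t / (m + 1) + b_m) with b_m >= 0:
every slope 1 / (m + 1) occurs, so w is sublinear. For each m pick a finite set
F_m of lattice points on which the sum for exp(|x| / (m + 1)) already exceeds
m, and then b_j at least the radius of every F_m with m < j. On F_m the
lines of index j > m lie above |x|, and those of index j <= m have slope at
least 1 / (m + 1). Therefore w(|x|) >= |x| / (m + 1) on F_m, and the sum for v
exceeds every m ([weighted_sum_exp_lt_pinfty]). *)

Set Implicit Arguments.
Unset Strict Implicit.
Unset Printing Implicit Defensive.

Local Open Scope classical_set_scope.
Local Open Scope ring_scope.

(** * The Euclidean norm *)

Section EuclideanNorm.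
Context {R : realType} {n : nat}.
Implicit Types x y : 'rV[R]_n.

Lemma euclidean_norm_ge0 x : 0 <= euclidean_norm x.
Proof. exact: sqrtr_ge0. Qed.

Lemma sqr_euclidean_norm x :
  euclidean_norm x ^+ 2 = \sum_(i < n) x ord0 i ^+ 2.
Proof. by rewrite sqr_sqrtr// sumr_ge0// => i _; exact: sqr_ge0. Qed.

Lemma euclidean_normN x : euclidean_norm (- x) = euclidean_norm x.
Proof.
by congr Num.sqrt; apply: eq_bigr => i _; rewrite mxE sqrrN.
Qed.

Lemma euclidean_normZ (a : R) x :
  euclidean_norm (a *: x) = `|a| * euclidean_norm x.
Proof.
rewrite -sqrtr_sqr -sqrtrM ?sqr_ge0// mulr_sumr; congr Num.sqrt.
by apply: eq_bigr => i _; rewrite mxE exprMn.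
Qed.

Lemma norm_coord_le_euclidean x i : `|x ord0 i| <= euclidean_norm x.
Proof.
rewrite -sqrtr_sqr ler_sqrt; last by apply: sumr_ge0 => j _; exact: sqr_ge0.
by rewrite (bigD1 i)//= lerDl sumr_ge0// => j _; exact: sqr_ge0.
Qed.

(** The Cauchy-Schwarz inequality: the sum of the squares of |y| x_i - |x| y_i
is twice |x| |y| times the gap between the two sides. *)
Lemma dotproduct_le_euclidean x y :
  \sum_(i < n) x ord0 i * y ord0 i <= euclidean_norm x * euclidean_norm y.
Proof.
have [xy0|xy0] := eqVneq (euclidean_norm x * euclidean_norm y) 0.
  rewrite xy0 big1// => i _; apply/eqP; rewrite -normr_le0 -xy0 normrM.
  by rewrite ler_pM// norm_coord_le_euclidean.
have {}xy0 : 0 < euclidean_norm x * euclidean_norm y.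
  by rewrite lt_def xy0 mulr_ge0// euclidean_norm_ge0.
have : 0 <= \sum_(i < n)
    (euclidean_norm y * x ord0 i - euclidean_norm x * y ord0 i) ^+ 2.
  by apply: sumr_ge0 => i _; exact: sqr_ge0.
suff -> : \sum_(i < n)
    (euclidean_norm y * x ord0 i - euclidean_norm x * y ord0 i) ^+ 2 =
    2 * (euclidean_norm x * euclidean_norm y) * (euclidean_norm x *
      euclidean_norm y - \sum_(i < n) x ord0 i * y ord0 i).
  by rewrite pmulr_rge0 ?subr_ge0// mulr_gt0.
transitivity (euclidean_norm y ^+ 2 * (\sum_(i < n) x ord0 i ^+ 2) +
  euclidean_norm x ^+ 2 * (\sum_(i < n) y ord0 i ^+ 2) -
  2 * (euclidean_norm x * euclidean_norm y) *
    \sum_(i < n) x ord0 i * y ord0 i).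
  rewrite !mulr_sumr -big_split -sumrB; apply: eq_bigr => i _ /=; ring.
rewrite -!sqr_euclidean_norm; ring.
Qed.

Lemma euclidean_normD x y :
  euclidean_norm (x + y) <= euclidean_norm x + euclidean_norm y.
Proof.
rewrite -ler_sqr ?nnegrE ?addr_ge0 ?euclidean_norm_ge0//.
rewrite sqrrD !sqr_euclidean_norm.
have -> : \sum_(i < n) (x + y) ord0 i ^+ 2 = \sum_(i < n) x ord0 i ^+ 2 +
    (\sum_(i < n) x ord0 i * y ord0 i) *+ 2 + \sum_(i < n) y ord0 i ^+ 2.
  rewrite -sumrMnl -!big_split/=; apply: eq_bigr => i _.
  by rewrite mxE sqrrD.
by rewrite lerD2r lerD2l lerMn2r dotproduct_le_euclidean orbT.
Qed.

Lemma continuous_euclidean_norm :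
  continuous (euclidean_norm : 'rV[R]_n -> R).
Proof.
have csum : continuous (fun x : 'rV[R]_n => \sum_(i < n) x ord0 i ^+ 2).
  apply: continuous_big => [|i _ x]; first exact: add_continuous.
  apply: (@continuous_comp _ _ _ (fun x : 'rV[R]_n => x ord0 i)
    (fun r : R => r ^+ 2)).
    exact: coord_continuous.
  exact: exprn_continuous.
move=> x; apply: (continuous_comp (csum x)); exact: sqrt_continuous.
Qed.

End EuclideanNorm.

(** * Continuous functions are locally essentially bounded *)

Section Measurability.
Context {R : realType} {n : nat}.

Lemma lebesgue_null0 : lebesgue_null (set0 : set 'rV[R]_n).
Proof.
apply/eqP; rewrite eq_le; apply/andP; split.
  apply: ereal_inf_lbound; exists set0, (fun=> 0), (fun=> 0).
  by rewrite esum_set0; split.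
apply: le_ereal_inf_tmp => _ [D [a [b [_ ->]]]].
apply: esum_ge0 => k _; rewrite lee_fin /box_vol.
by apply: prodr_ge0 => i _; rewrite le_max lexx.
Qed.

(** The preimage of a Borel set is Borel, because open intervals generate the
Borel sets of the line. *)
Lemma continuous_lebesgue_measurable_fun (v : 'rV[R]_n -> R) :
  continuous v -> lebesgue_measurable_fun v.
Proof.
move=> cv Y mY; exists (v @^-1` Y); last first.
  by rewrite setDv setU0; exact: lebesgue_null0.
suff sub : <<s @RGenOpens.G R >> `<=` image_set_system setT v borel.
  have : <<s @RGenOpens.G R >> Y.
    have := @RGenOpens.measurableE R; rewrite /measurable/= => <-; exact: mY.
  by move=> /sub; rewrite /image_set_system/= setTI.
apply: smallest_sub.
  by apply: sigma_algebra_image; exact: smallest_sigma_algebra.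
move=> _ [x [y ->]]; rewrite /image_set_system/= setTI.
apply: sub_sigma_algebra => /=; apply: open_comp; last exact: interval_open.
by move=> ? _; exact: cv.
Qed.

Lemma continuous_Linfty_loc (v : 'rV[R]_n -> R) :
  continuous v -> Linfty_loc v.
Proof.
move=> cv; split; first exact: continuous_lebesgue_measurable_fun.
move=> K cK.
have /compact_bounded[M [_ MvK]] : compact (v @` K).
  by apply: continuous_compact => //; exact: continuous_subspaceT.
exists (M + 1); suff -> : K `&` [set x | M + 1 < `|v x|] = set0.
  exact: lebesgue_null0.
apply/seteqP; split => // x [Kx /=]; apply/negP; rewrite -leNgt.
by apply: MvK; [rewrite ltrDl|exists x].
Qed.

End Measurability.

(** * Sublinear envelopes of affine functions *)

Section Envelope.
Context {R : realType} (b : nat -> R) (b_ge0 : forall m, 0 <= b m).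
Implicit Types s t y : R.

Definition envelope t : R := inf [set t / m.+1%:R + b m | m in [set: nat]].

Lemma envelope_geP t y :
  (forall m, y <= t / m.+1%:R + b m) -> y <= envelope t.
Proof.
move=> yt; apply: lb_le_inf; first by exists (t / 1%:R + b 0), 0%N.
by move=> _ [m _ <-].
Qed.

(** The slopes lie in ]0, 1], so - |t| bounds the family from below and the
infimum is a genuine one for negative t as well. *)
Lemma envelope_le t m : envelope t <= t / m.+1%:R + b m.
Proof.
apply: ge_inf; last by exists m.
exists (- `|t|) => _ [k _ <-]; rewrite -[leLHS]addr0 lerD//.
have : `|t / k.+1%:R| <= `|t|.
  by rewrite normrM ler_piMr// ger0_norm// invf_le1// ler1n.
by rewrite ler_norml => /andP[].
Qed.

Lemma envelope_ge0 t : 0 <= t -> 0 <= envelope t.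
Proof.
by move=> t0; apply: envelope_geP => m; rewrite addr_ge0// divr_ge0.
Qed.

(** An infimum of functions that are Lipschitz with constant 1. *)
Lemma envelope_lipschitz s t : envelope s <= envelope t + `|s - t|.
Proof.
rewrite -lerBlDr; apply: envelope_geP => m; rewrite lerBlDr.
apply: (le_trans (envelope_le s m)).
rewrite [leRHS]addrAC lerD2r -lerBlDl -mulrBl.
rewrite (le_trans (ler_norm _))// normrM ler_piMr// ger0_norm//.
by rewrite invf_le1// ler1n.
Qed.

Lemma envelope_nondecreasing s t : s <= t -> envelope s <= envelope t.
Proof.
move=> st; apply: envelope_geP => m; apply: (le_trans (envelope_le s m)).
by rewrite lerD2r ler_pM2r.
Qed.

(** Given one line for s and one for t, the flatter of the two is a competitor
at s + t whose value is at most the sum of the two values: its slope is the smaller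
one and its intercept is counted once. *)
Lemma envelope_subadditive s t : 0 <= s -> 0 <= t ->
  envelope (s + t) <= envelope s + envelope t.
Proof.
move=> s0 t0; rewrite -lerBlDl; apply: envelope_geP => k.
rewrite lerBlDl -lerBlDr; apply: envelope_geP => m; rewrite lerBlDr.
wlog mk : s t s0 t0 m k / (m <= k)%N => [th|].
  have [/th|/ltnW/th] := leqP m k; first exact.
  by rewrite addrC [leRHS]addrC; apply.
apply: (le_trans (envelope_le _ k)).
have stm : s / k.+1%:R <= s / m.+1%:R.
  by rewrite ler_wpM2l// lef_pV2 ?posrE// ler_nat.
by rewrite mulrDl -addrA lerD// (le_trans stm)// lerDl.
Qed.

(** Dividing the line of index m at l t by l leaves t / (m + 1) + b_m / l; first
m and then l is chosen large. *)
Lemma envelope_sublinear t :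
  0 <= t -> envelope (l%:R * t) / l%:R @[l --> \oo] --> (0 : R).
Proof.
move=> t0; apply/cvgrPdist_le => e e0.
pose m := Num.truncn (t / (e / 2)).
pose N := Num.truncn (b m / (e / 2)).
have tm : t / m.+1%:R <= e / 2.
  rewrite ler_pdivrMr// mulrC -ler_pdivrMr ?divr_gt0//.
  by rewrite ltW// truncnS_gt.
exists N.+1 => //= l Nl.
have l0 : 0 < l%:R :> R by rewrite ltr0n (leq_trans _ Nl).
have bl : b m / l%:R <= e / 2.
  rewrite ler_pdivrMr// mulrC -ler_pdivrMr ?divr_gt0//.
  by rewrite ltW// (lt_le_trans (truncnS_gt _))// ler_nat.
rewrite sub0r normrN ger0_norm; last first.
  by rewrite divr_ge0// envelope_ge0// mulr_ge0.
apply: (@le_trans _ _ ((l%:R * t / m.+1%:R + b m) / l%:R)).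
  by rewrite ler_pM2r ?invr_gt0// envelope_le.
rewrite mulrDl mulrAC [l%:R * t]mulrC mulfK ?gt_eqF//.
by rewrite [leRHS](splitr e) lerD.
Qed.

Lemma continuous_envelope : continuous envelope.
Proof.
move=> t; apply/cvgrPdist_le => e e0; near=> s.
have ts : `|t - s| <= e by near: s; move: e e0; apply/cvgrPdist_le.
have st : `|s - t| <= e by rewrite distrC.
have := envelope_lipschitz s t; have := envelope_lipschitz t s.
by rewrite ler_norml => ? ?; apply/andP; split; lra.
Unshelve. all: by end_near. Qed.

End Envelope.

(** * The weights attached to envelopes *)

Section EnvelopeWeight.
Context {R : realType} {n : nat} (b : nat -> R) (b_ge0 : forall m, 0 <= b m).

Definition envelope_weight (x : 'rV[R]_n) : R :=
  expR (envelope b (euclidean_norm x)).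

Lemma continuous_envelope_weight : continuous envelope_weight.
Proof.
move=> x; apply: (@continuous_comp _ _ _
  (fun x : 'rV[R]_n => envelope b (euclidean_norm x)) (@expR R)); last first.
  exact: continuous_expR.
apply: (@continuous_comp _ _ _ (@euclidean_norm R n)).
  exact: continuous_euclidean_norm.
exact: continuous_envelope.
Qed.

Lemma envelope_weight_submultiplicative : submultiplicative envelope_weight.
Proof.
split=> [x|x y]; first by rewrite /envelope_weight euclidean_normN.
rewrite -expRD ler_expR.
apply: le_trans (envelope_subadditive b_ge0 (euclidean_norm_ge0 x)
  (euclidean_norm_ge0 y)).
exact: (envelope_nondecreasing _ (euclidean_normD x y)).
Qed.

Lemma envelope_weight_GRS : GRS_condition envelope_weight.
Proof.
move=> x; have := envelope_sublinear b_ge0 (euclidean_norm_ge0 x).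
have -> : (fun l : nat => envelope_weight (l%:R *: x) `^ l%:R^-1) =
  expR \o (fun l : nat => envelope b (l%:R * euclidean_norm x) / l%:R).
  apply/funext => l /=; rewrite /envelope_weight euclidean_normZ.
  by rewrite ger0_norm// /powR gt_eqF ?expR_gt0// expRK mulrC.
move=> cvg0.
have := @cvg_comp _ _ _ _ _ _ _ _ cvg0 (@continuous_expR R 0).
by rewrite expR0.
Qed.

Lemma Omega_envelope_weight : Omega R n envelope_weight.
Proof.
split; last exact: envelope_weight_GRS; last first.
  exact: envelope_weight_submultiplicative.
split=> [x|]; first exact: expR_gt0.
exact: continuous_Linfty_loc continuous_envelope_weight.
Qed.

End EnvelopeWeight.

(** * Weights satisfying the GRS-condition grow subexponentially *)

Section GrowthBound.
Context {R : realType} {n : nat}.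
Implicit Types (v : 'rV[R]_n -> R) (x : 'rV[R]_n) (e : R).

(** From some rank on v(l x)^(1 / l) is below exp e; the constant absorbs the
finitely many earlier values. *)
Lemma GRS_ray_bound v x e : (forall x, 0 < v x) -> GRS_condition v -> 0 < e ->
  exists2 C, 0 <= C & forall l : nat, v (l%:R *: x) <= C * expR (e * l%:R).
Proof.
move=> v0 /(_ x) vx e0.
have /(cvgr_lt 1 vx)[N _ vN] : 1 < expR e by rewrite expR_gt1.
exists (1 + \sum_(l < N.+1) v (l%:R *: x)).
  by rewrite addr_ge0// sumr_ge0// => l _; exact: ltW.
move=> l; have [lN|Nl] := ltnP l N.+1.
  have vle : v (l%:R *: x) <= 1 + \sum_(l < N.+1) v (l%:R *: x).
    rewrite (bigD1 (Ordinal lN))//= addrCA lerDl addr_ge0// sumr_ge0// => j _.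
    exact: ltW.
  apply: (le_trans vle); rewrite ler_peMr ?(le_trans (ltW (v0 _)) vle)//.
  by rewrite -expR0 ler_expR mulr_ge0// ltW.
have l0 : 0 < l%:R :> R by rewrite ltr0n (leq_ltn_trans _ Nl).
have := vN l (ltnW Nl); rewrite /= /powR gt_eqF// ltr_expR mulrC.
rewrite ltr_pdivrMr// => /ltW lnv.
have vle : v (l%:R *: x) <= expR (e * l%:R).
  by rewrite -[leLHS]lnK ?posrE// ler_expR.
apply: (le_trans vle); rewrite ler_peMl ?expR_ge0// lerDl.
by rewrite sumr_ge0// => j _; exact: ltW.
Qed.

(** The factor v 0 accounts for the empty sum, since submultiplicativity only
gives v 0 >= 1. *)
Lemma submultiplicative_sum v (I : Type) (r : seq I) (f : I -> 'rV[R]_n) :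
  (forall x, 0 < v x) -> submultiplicative v ->
  v (\sum_(i <- r) f i) <= v 0 * \prod_(i <- r) v (f i).
Proof.
move=> v0 [_ vD]; elim: r => [|i r IHr]; first by rewrite !big_nil mulr1.
rewrite !big_cons mulrCA (le_trans (vD _ _))// ler_pM2l//.
Qed.

(** A lattice point is the sum of the k_i e_i, and evenness reduces the integers
k_i to naturals. *)
Lemma GRS_exp_bound v e : (forall x, 0 < v x) -> submultiplicative v ->
  GRS_condition v -> 0 < e ->
  exists2 C, 0 <= C & forall k : 'rV[int]_n,
    v (int_point k) <= C * exp_weight e (int_point k).
Proof.
move=> v0 subv grsv e0; pose e' := e / n.+1%:R.
(* The rates add up to at most e' n |k|, and the successor keeps e' defined in
   dimension 0. *)
have e'0 : 0 < e' by rewrite divr_gt0.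
have [C C0 vC] : exists2 C : 'I_n -> R, (forall i, 0 <= C i) &
    forall i (l : nat), v (l%:R *: 'e_i) <= C i * expR (e' * l%:R).
  have /fin_all_exists2[C] i :=
    @GRS_ray_bound v ('e_i : 'rV[R]_n) e' v0 grsv e'0.
  by exists C.
exists (v 0 * \prod_(i < n) C i).
  by rewrite mulr_ge0 ?(ltW (v0 _))// prodr_ge0.
move=> k; rewrite {1}(row_sum_delta (int_point k)).
apply: (le_trans (submultiplicative_sum _ _ v0 subv)).
rewrite -mulrA ler_pM2l//.
apply: (@le_trans _ _ (\prod_(i < n)
    (C i * expR (e' * `|int_point k ord0 i : R|)))).
  apply: ler_prod => i _; rewrite ltW//= mxE.
  have -> : v ((k ord0 i)%:~R *: 'e_i) = v (`|k ord0 i|%N%:R *: 'e_i).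
    case: (k ord0 i) => m; first by [].
    by rewrite NegzE mulrNz scaleNr subv.1.
  by rewrite -intr_norm -natr_absz; exact: vC.
rewrite big_split/=; apply: ler_wpM2l; first exact: prodr_ge0.
rewrite -expR_sum ler_expR -mulr_sumr.
rewrite /e' -mulrA ler_pM2l// mulrC ler_pdivrMr//.
apply: (@le_trans _ _ (\sum_(i < n) euclidean_norm (int_point k : 'rV[R]_n))).
  by apply: ler_sum => i _; exact: norm_coord_le_euclidean.
rewrite sumr_const card_ord -[leLHS]mulr_natr ler_wpM2l ?euclidean_norm_ge0//.
by rewrite ler_nat.
Qed.

End GrowthBound.

(** * Sums against exponential weights and against Omega *)

Section WeightedSums.
Context {R : realType} {n : nat} (s : 'rV[int]_n -> \bar R).
Context (s_ge0 : forall k, (0 <= s k)%E).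

Definition weighted_sum (v : 'rV[R]_n -> R) : \bar R :=
  \esum_(k in [set: 'rV[int]_n]) (s k * (v (int_point k))%:E)%E.

Lemma weighted_sum_le_scale (C : R) v w : 0 <= C -> (forall x, 0 <= w x) ->
  (forall k, v (int_point k) <= C * w (int_point k)) ->
  (weighted_sum v <= C%:E * weighted_sum w)%E.
Proof.
move=> C0 w0 vw; apply: ge_ereal_sup => _ [X [finX _] <-].
apply: (@le_trans _ _ (C%:E * \sum_(k \in X) (s k * (w (int_point k))%:E))%E).
  rewrite ge0_mule_fsumr; last by move=> k; rewrite mule_ge0// lee_fin.
  apply: lee_fsum => // k _; rewrite muleCA lee_wpmul2l// -EFinM lee_fin.
  exact: vw.
rewrite lee_wpmul2l ?lee_fin//; apply: esum_ge.
by exists X => //; split.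
Qed.

Lemma weighted_sum_Omega_lt_pinfty e v : 0 < e -> Omega R n v ->
  (weighted_sum (exp_weight e) < +oo)%E -> (weighted_sum v < +oo)%E.
Proof.
move=> e0 [[v0 _] subv grsv] fin_e.
have [C C0 vC] := GRS_exp_bound v0 subv grsv e0.
apply: le_lt_trans (weighted_sum_le_scale C0 _ vC) _.
  by move=> x; exact: expR_ge0.
by rewrite lte_mul_pinfty ?lee_fin.
Qed.

Lemma finite_set_norm_bound (F : set 'rV[int]_n) : finite_set F ->
  exists2 t : R, 0 <= t &
    forall k, F k -> euclidean_norm (int_point k : 'rV[R]_n) <= t.
Proof.
move=> /finite_seqP[r ->]; exists (\sum_(k <- r)
    euclidean_norm (int_point k : 'rV[R]_n)).
  by rewrite sumr_ge0// => k _; exact: euclidean_norm_ge0.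
move=> k /= rk; rewrite (big_rem k)//=.
by rewrite lerDl sumr_ge0// => j _; exact: euclidean_norm_ge0.
Qed.

(** By contraposition: if every exponential weight gives an infinite sum, finite
sets with large partial sums determine an envelope weight whose sum is infinite
too. *)
Lemma weighted_sum_exp_lt_pinfty :
  (forall v, Omega R n v -> (weighted_sum v < +oo)%E) ->
  exists2 e : R, 0 < e & (weighted_sum (exp_weight e) < +oo)%E.
Proof.
move=> fin_Omega; apply: contrapT => noe.
have /choice[F FP] m : exists F : set 'rV[int]_n, finite_set F /\
    (m%:R%:E <= \sum_(k \in F)
       (s k * (exp_weight m.+1%:R^-1 (int_point k))%:E))%E.
  have : (m%:R%:E < weighted_sum (exp_weight m.+1%:R^-1))%E.
    rewrite ltNge; apply/negP => le_m; apply: noe.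
    by exists m.+1%:R^-1 => //; exact: le_lt_trans le_m (ltry _).
  by move=> /ereal_sup_gt[_ [F [finF _] <-] /ltW ?]; exists F.
have /choice[t tP] m : exists t : R, 0 <= t /\
    forall k, F m k -> euclidean_norm (int_point k : 'rV[R]_n) <= t.
  by have [t] := finite_set_norm_bound (FP m).1; exists t.
(* The intercept b_m is at least t_j for every j < m, so on F_j the lines of
   index larger than j stay above the norm. *)
pose b m := \sum_(j < m) t j.
have b0 m : 0 <= b m by apply: sumr_ge0 => j _; exact: (tP j).1.
have := fin_Omega _ (Omega_envelope_weight b0).
rewrite ltNge => /negP; apply; rewrite leye_eq; apply/eqP/eq_infty => r.
pose m := (Num.truncn r).+1.
have rm : r <= m%:R by rewrite ltW// truncnS_gt.
apply: (@le_trans _ _ m%:R%:E); first by rewrite lee_fin.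
apply: (le_trans (FP m).2); apply: esum_ge; exists (F m).
  by split => //; exact: (FP m).1.
apply: lee_fsum; first exact: (FP m).1.
move=> k Fk; rewrite lee_wpmul2l// lee_fin ler_expR.
have t0 := euclidean_norm_ge0 (int_point k : 'rV[R]_n).
apply: envelope_geP => j; have [jm|mj] := leqP j m.
  rewrite -[leLHS]addr0 lerD// mulrC ler_wpM2l// lef_pV2 ?posrE//.
  by rewrite ler_nat.
rewrite -[leLHS]add0r lerD ?divr_ge0//.
apply: (@le_trans _ _ (t m)).
  apply: le_trans ((tP m).2 _ Fk); rewrite ler_piMl// invf_le1// ler1n//.
by rewrite /b (bigD1 (Ordinal mj))//= lerDl sumr_ge0// => i _; exact: (tP i).1.
Qed.

Lemma weighted_sum_expP :
  (exists2 e : R, 0 < e & (weighted_sum (exp_weight e) < +oo)%E) <->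
  (forall v, Omega R n v -> (weighted_sum v < +oo)%E).
Proof.
split=> [[e e0 fin_e] v Ov|]; last exact: weighted_sum_exp_lt_pinfty.
exact: weighted_sum_Omega_lt_pinfty Ov fin_e.
Qed.

End WeightedSums.

(** Sequence spaces and matrix algebras are the instances where s lists the
moduli of the entries, respectively the suprema along the side diagonals. *)
Lemma bigcup_exp_weight_bigcap_Omega (R : realType) (n : nat) (T : Type)
    (W : ('rV[R]_n -> R) -> set T) (s : T -> 'rV[int]_n -> \bar R) :
  (forall c k, (0 <= s c k)%E) ->
  (forall v c, W v c <-> (weighted_sum (s c) v < +oo)%E) ->
  \bigcup_(e in [set e : R | 0 < e]) W (exp_weight e) =
  \bigcap_(v in Omega R n) W v.
Proof.
move=> s_ge0 WE; apply/seteqP; split=> c.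
  move=> [e e0 /WE ce] v Ov; apply/WE.
  by apply: (weighted_sum_expP (s_ge0 c)).1 Ov; exists e.
move=> cOmega; have [|e e0 ce] := (weighted_sum_expP (s_ge0 c)).2 _.
  by move=> v Ov; apply/WE; exact: cOmega.
by exists e => //; apply/WE.
Qed.

Lemma normc_ge0 (R : realType) (z : R[i]) : 0 <= ComplexField.Normc.normc z.
Proof. by case: z => a b; exact: sqrtr_ge0. Qed.

Theorem corollary2 (R : realType) (d : nat) :
  \bigcup_(e in [set e : R | 0 < e])
      weighted_l1 (exp_weight e : 'rV[R]_(2 * d) -> R)
    = \bigcap_(v in Omega R (2 * d)) weighted_l1 v
  /\
  \bigcup_(e in [set e : R | 0 < e])
      weighted_matrices (exp_weight e : 'rV[R]_(2 * d) -> R)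
    = \bigcap_(v in Omega R (2 * d)) weighted_matrices v.
Proof.
split.
  apply: (bigcup_exp_weight_bigcap_Omega
    (s := fun c k => (ComplexField.Normc.normc (c k))%:E)) => [c k|v c].
    by rewrite lee_fin normc_ge0.
  suff -> : weighted_sum (fun k => (ComplexField.Normc.normc (c k))%:E) v =
      (\esum_(k in [set: 'rV[int]_(2 * d)])
        (ComplexField.Normc.normc (c k) * v (int_point k))%:E)%E by [].
  by apply: eq_esum => k _; rewrite EFinM.
apply: (bigcup_exp_weight_bigcap_Omega (s := fun a k => ereal_sup
  [set (ComplexField.Normc.normc (a j (j - k)))%:E |
    j in [set: 'rV[int]_(2 * d)]])) => [a k|//].
apply: (@le_trans _ _ (ComplexField.Normc.normc (a 0 (0 - k)))%:E).
  by rewrite lee_fin normc_ge0.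
by apply: ereal_sup_ubound; exists 0.
Qed.
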